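(* Let $m\ge1$, $n\ge1$, $p\ge2$, and let $\psi:\mathbb{R}^m_+\to\mathbb{R}_+$ be convex, differentiable, non-decreasing, with $\psi(0)=0$, with non-decreasing gradient, and with growth of order at most $p$. Let $v_1,\dots,v_n\in[0,1]^m$, let $\bar\gamma\le\frac1{4p}$, and let $\gamma_1,\dots,\gamma_n\in\{0,\bar\gamma\}$ with $\sum_t\gamma_t=1$. Let $\bar y_1,\dots,\bar y_n$ be the iterates of SSFTRL. Then: 1. (Regret) $\sum_{t=1}^n L_{\gamma_t}(\bar y_t,\tfrac12 v_t)\ge\psi\big(\tfrac18\sum_t v_t\big)-\psi(p\mathbf{1})$. 2. (Size control) $\frac1p\max_t\psi^*(\bar y_t)\le\sum_t\langle\bar y_t,v_t\rangle+\psi(p\mathbf{1})$. 3. (Separable case) If in addition $\psi$ is separable, then $\frac1p\psi^*\big(\bigvee_t\bar y_t\big)\le\sum_t\langle\bar y_t,v_t\rangle+\psi(p\mathbf{1})$. 4. (Almost monotone) There is a set $\mathcal{T}\subseteq[n]$ of size $p$ such that for every $t$ there is $t'\in\mathcal{T}$ with $\bar y_t\le e\cdot\bar y_{t'}$.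
   Context: Vectors are compared coordinatewise; $\mathbf{1}$ is the all-ones vector. ''Non-decreasing gradient'': $u\le u'\Rightarrow\nabla\psi(u)\le\nabla\psi(u')$. ''Growth of order at most $p$'': $\nabla\psi(\gamma u)\le\gamma^{p-1}\nabla\psi(u)$ for all $u\in\mathbb{R}^m_+$, $\gamma\ge1$. ''Separable'': $\psi(u)=\sum_i\psi_i(u_i)$ for one-dimensional $\psi_i$. The Fenchel conjugate is $\psi^*(y):=\sup_{u\in\mathbb{R}^m_+}(\langle u,y\rangle-\psi(u))$. For $\gamma\ge0$, $L_\gamma(y,v):=\langle y,v\rangle-\gamma\psi^*(y)$. $\bigvee_t\bar y_t$ denotes the coordinatewise maximum of the vectors $\bar y_t$. Write $v_{1:t}=v_1+\dots+v_t$ and $\gamma_{1:t}=\gamma_1+\dots+\gamma_t$ (empty sums are $0$). SSFTRL (Shifted and Scaled Follow the Regularized Leader) plays, at each time $t$, $$\bar y_t:=\nabla\psi\Big(\frac{4p\mathbf{1}+v_{1:t-1}}{4(1+\gamma_{1:t-1}+\bar\gamma)}\Big).$$ *)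

(* Defs.v *)
From mathcomp Require Import all_boot all_order all_algebra.
From mathcomp Require Import all_classical all_reals all_analysis.
From mathcomp Require Import ring.

Set Implicit Arguments.
Unset Strict Implicit.
Unset Printing Implicit Defensive.

Import Order.TTheory GRing.Theory Num.Theory.
Import numFieldNormedType.Exports.

Local Open Scope classical_set_scope.
Local Open Scope ring_scope.

Definition vle (R : realType) (m : nat) (u w : 'rV[R]_m) : Prop :=
  forall i, u 0 i <= w 0 i.

Definition dot (R : realType) (m : nat) (u w : 'rV[R]_m) : R :=
  \sum_i u 0 i * w 0 i.

Definition orthant (R : realType) (m : nat) : set 'rV[R]_m :=
  [set u | vle 0 u].
Arguments orthant : clear implicits.

(* A function on the closed orthant is represented by a total function whose
   values outside the orthant are never used.  In particular differentiability
   is relative to the orthant (one-sided at boundary points). *)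
Definition is_gradient (R : realType) (m : nat) (psi : 'rV[R]_m -> R)
    (u g : 'rV[R]_m) : Prop :=
  let F := within (orthant R m) (nbhs u) in
  (fun w => psi w - psi u - dot g (w - u) : R^o) =o_F (fun w => w - u).

Definition differentiable_on_orthant (R : realType) (m : nat)
    (psi : 'rV[R]_m -> R) : Prop :=
  forall u, orthant R m u -> exists g, is_gradient psi u g.

(* For u in the orthant the gradient is unique when it exists
   (is_gradient_unique below); the default 0 is junk. *)
Definition grad (R : realType) (m : nat) (psi : 'rV[R]_m -> R)
    (u : 'rV[R]_m) : 'rV[R]_m :=
  xget 0 [set g | is_gradient psi u g].

Lemma is_gradient_unique (R : realType) (m : nat) (psi : 'rV[R]_m -> R)
    (u g g' : 'rV[R]_m) :
  orthant R m u -> is_gradient psi u g -> is_gradient psi u g' -> g = g'.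
Proof.
move=> u0 /eqoP gP /eqoP gP'.
apply/rowP => i; apply/eqP; rewrite -subr_eq0 -normr_le0.
apply/ler_addgt0Pr => e e0; rewrite add0r.
have e20 : 0 < e / 2 by rewrite divr_gt0.
have : \forall w \near u, orthant R m w ->
    `|psi w - psi u - dot g (w - u)| <= e / 2 * `|w - u| /\
    `|psi w - psi u - dot g' (w - u)| <= e / 2 * `|w - u|.
  exact: filterI (gP _ e20) (gP' _ e20).
move/nbhs_normP => [r /= r0 rP].
pose s := r / 2; have s0 : 0 < s by rewrite divr_gt0.
pose w := u + s *: delta_mx 0 i.
have wE : w - u = s *: delta_mx 0 i by rewrite addrC addKr.
have ns : `|w - u| <= s.
  rewrite wE normrZ gtr0_norm// ger_pMr//.
  rewrite [leLHS]mx_normrE; apply/bigmax_leP; split => //= k _.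
  by rewrite mxE; case: (_ && _); rewrite ?normr1 ?normr0.
have dotE (h : 'rV[R]_m) : dot h (w - u) = h 0 i * s.
  rewrite wE /dot (bigD1 i)//= big1 ?addr0.
    by rewrite !mxE !eqxx mulr1.
  by move=> j ji; rewrite !mxE (negbTE ji) andbF !mulr0.
have [||] := rP w.
- rewrite /= -normrN opprB; apply: le_lt_trans ns _.
  by rewrite ltr_pdivrMr// ltr_pMr// ltr1n.
- move=> j; rewrite !mxE addr_ge0 ?u0//; first by have := u0 j; rewrite mxE.
  by rewrite mulr_ge0 ?ler0n// ltW.
rewrite !dotE => h1 h2.
have h : `|(g 0 i - g' 0 i) * s| <= e * s.
  rewrite (_ : _ * s = (psi w - psi u - g' 0 i * s)
                     - (psi w - psi u - g 0 i * s)); last first.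
    ring.
  apply: le_trans (ler_normB _ _) _.
  apply: le_trans (lerD h2 h1) _.
  by rewrite -mulrDl -splitr ler_wpM2l// ltW.
by move: h; rewrite normrM (gtr0_norm s0) ler_pM2r.
Qed.

Definition monotone_on_orthant (R : realType) (m : nat)
    (psi : 'rV[R]_m -> R) : Prop :=
  forall u w, orthant R m u -> orthant R m w -> vle u w -> psi u <= psi w.

Definition monotone_gradient (R : realType) (m : nat)
    (psi : 'rV[R]_m -> R) : Prop :=
  forall u w, orthant R m u -> orthant R m w -> vle u w ->
    vle (grad psi u) (grad psi w).

Definition growth_at_most (R : realType) (m : nat) (p : R)
    (psi : 'rV[R]_m -> R) : Prop :=
  forall (u : 'rV[R]_m) (c : R), orthant R m u -> 1 <= c ->
    vle (grad psi (c *: u)) (c `^ (p - 1) *: grad psi u).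

Definition separable (R : realType) (m : nat) (psi : 'rV[R]_m -> R) : Prop :=
  exists psi1 : 'I_m -> R -> R,
    forall u, orthant R m u -> psi u = \sum_i psi1 i (u 0 i).

Definition fenchel (R : realType) (m : nat) (psi : 'rV[R]_m -> R)
    (y : 'rV[R]_m) : \bar R :=
  ereal_sup [set (dot u y - psi u)%:E | u in orthant R m].

(* With c = 0 the second term is 0, as 0 * +oo = 0 in \bar R. *)
Definition Lgame (R : realType) (m : nat) (psi : 'rV[R]_m -> R)
    (c : R) (y v : 'rV[R]_m) : \bar R :=
  ((dot y v)%:E - c%:E * fenchel psi y)%E.

(* Times are 0-based: for t : 'I_n the prefix sums range over s < t. *)
Definition ssftrl (R : realType) (m n : nat) (psi : 'rV[R]_m -> R) (p gbar : R)
    (v : 'I_n -> 'rV[R]_m) (gamma : 'I_n -> R) (t : 'I_n) : 'rV[R]_m :=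
  grad psi
    ((4 * (1 + \sum_(s < n | (s < t)%N) gamma s + gbar))^-1 *:
       (const_mx (4 * p) + \sum_(s < n | (s < t)%N) v s)).

(* The sup is over a finite set, nonempty for n > 0, hence a maximum. *)
Definition vmax (R : realType) (m n : nat) (y : 'I_n -> 'rV[R]_m) : 'rV[R]_m :=
  \row_i sup (range (fun t => y t 0 i)).

(* Main.v *)
Require Import Defs.
From mathcomp Require Import all_boot all_order all_algebra.
From mathcomp Require Import all_classical all_reals all_analysis.
From mathcomp Require Import ring lra.

(* Write S_t = 4p1 + v_{1:t-1} and g_t = 1 + gamma_{1:t-1}.  The potential
   g_t psi (S_t / (4 g_t)) starts at psi (p1), and each round increases it by at
   most <y_t, v_t / 2> - gamma_t psi^* (y_t): raising g is paid for by
   Fenchel-Young at y_t, adding v_t by convexity, and the gradients at the points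
   involved differ by a factor at most (1 + 1/(4p))^(2(p-1)) <= e^(1/2) <= 2.
   Summing up to n gives the regret bound.  Summing up to t gives the size bound,
   since growth of order p implies <grad psi u, u> <= (p+1) psi u, hence
   psi^* (grad psi u) <= p psi u.  In the separable case the size bound is applied
   to each coordinate.  For almost monotonicity, y_s <= e^((g_t - g_s)(p-1)) y_t
   for s <= t, so it suffices to cut the range [1, 2] of g into floor p buckets of
   width 1/(p-1) and keep the last time of each. *)

Set Implicit Arguments.
Unset Strict Implicit.
Unset Printing Implicit Defensive.

Import Order.TTheory GRing.Theory Num.Theory.
Import numFieldNormedType.Exports.

Local Open Scope classical_set_scope.
Local Open Scope ring_scope.

(** * Coordinatewise order and inner product *)

Section vectors.
Context {R : realType} {m : nat}.
Implicit Types (u w g h : 'rV[R]_m) (a : R).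

Lemma orthantP u : orthant R m u <-> forall i, 0 <= u 0 i.
Proof. by split=> [u0 i|u0 i]; [have := u0 i|]; rewrite mxE. Qed.

Lemma orthant0 : orthant R m 0.
Proof. by apply/orthantP => i; rewrite mxE. Qed.

Lemma orthantD u w : orthant R m u -> orthant R m w -> orthant R m (u + w).
Proof.
move=> /orthantP u0 /orthantP w0; apply/orthantP => i.
by rewrite mxE addr_ge0.
Qed.

Lemma orthantZ a u : 0 <= a -> orthant R m u -> orthant R m (a *: u).
Proof.
by move=> a0 /orthantP u0; apply/orthantP => i; rewrite mxE mulr_ge0.
Qed.

Lemma orthant_const a : 0 <= a -> orthant R m (const_mx a).
Proof. by move=> a0; apply/orthantP => i; rewrite mxE. Qed.

Lemma orthant_sum (I : finType) (P : pred I) (F : I -> 'rV[R]_m) :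
  (forall i, orthant R m (F i)) -> orthant R m (\sum_(i | P i) F i).
Proof.
by move=> F0; elim/big_ind: _ => //; exact: orthantD.
Qed.

Lemma vle_trans u w g : vle u w -> vle w g -> vle u g.
Proof. by move=> uw wg i; apply: le_trans (uw i) (wg i). Qed.

Lemma dotDr g u w : dot g (u + w) = dot g u + dot g w.
Proof. by rewrite -big_split; apply: eq_bigr => i _; rewrite mxE mulrDr. Qed.

Lemma dotZr g a u : dot g (a *: u) = a * dot g u.
Proof. by rewrite mulr_sumr; apply: eq_bigr => i _; rewrite mxE mulrCA. Qed.

Lemma dotNr g u : dot g (- u) = - dot g u.
Proof. by rewrite -scaleN1r dotZr mulN1r. Qed.

Lemma dotBr g u w : dot g (u - w) = dot g u - dot g w.
Proof. by rewrite dotDr dotNr. Qed.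

Lemma dot0r g : dot g 0 = 0.
Proof. by apply: big1 => i _; rewrite mxE mulr0. Qed.

Lemma dotC g h : dot g h = dot h g.
Proof. by apply: eq_bigr => i _; rewrite mulrC. Qed.

Lemma dotZl g a u : dot (a *: g) u = a * dot g u.
Proof. by rewrite dotC dotZr dotC. Qed.

Lemma dot_ge0 g u : orthant R m g -> orthant R m u -> 0 <= dot g u.
Proof.
move=> /orthantP g0 /orthantP u0.
by apply: sumr_ge0 => i _; rewrite mulr_ge0.
Qed.

Lemma dot_lel g h u : vle g h -> orthant R m u -> dot g u <= dot h u.
Proof.
move=> gh /orthantP u0.
by apply: ler_sum => i _; rewrite ler_wpM2r.
Qed.

Lemma sum_ord_ltS (V : nmodType) (n : nat) (F : 'I_n -> V) (t : 'I_n) :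
  \sum_(s < n | (s < t.+1)%N) F s = \sum_(s < n | (s < t)%N) F s + F t.
Proof.
rewrite (bigD1 t)//= addrC; congr (_ + _); apply: eq_bigl => s.
by rewrite ltnS andbC -(inj_eq val_inj) ltn_neqAle.
Qed.

End vectors.

(** * Growing subgradients: sign, conjugate and Euler-type bound *)

(* [H] is any selection of subgradients rather than the gradient of [phi], so
   that one coordinate of a separable function is covered (see
   [axis_subgradient]) without computing its derivative. *)
Record growing_subgradient (R : realType) (m : nat) (p : R)
    (phi : 'rV[R]_m -> R) (H : 'rV[R]_m -> 'rV[R]_m) : Prop := {
  subgradient_le : forall u w, orthant R m u -> orthant R m w ->
    phi u + dot (H u) (w - u) <= phi w;
  subgradient_mono : forall u w, orthant R m u -> orthant R m w ->
    vle u w -> vle (H u) (H w);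
  subgradient_growth : forall u (c : R), orthant R m u -> 1 <= c ->
    vle (H (c *: u)) (c `^ (p - 1) *: H u);
  subgradient_fun0 : phi 0 = 0
}.

(* By Fenchel-Young this is the value at [H u] of the conjugate of [phi]. *)
Definition conj_at (R : realType) (m : nat) (phi : 'rV[R]_m -> R)
  (H : 'rV[R]_m -> 'rV[R]_m) u := dot (H u) u - phi u.

Section subgradient.
Context {R : realType} {m : nat} {p : R}.
Variables (phi : 'rV[R]_m -> R) (H : 'rV[R]_m -> 'rV[R]_m).
Hypotheses (p_ge2 : 2 <= p) (phiH : growing_subgradient p phi H).
Implicit Types u w : 'rV[R]_m.

(** Growth is applied at [c = expR z], so that later ratios of points need only
    [1 + x <= expR x]. *)
Lemma subgradient_le_expR u w z : orthant R m u -> orthant R m w -> 0 <= z ->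
  vle w (expR z *: u) -> vle (H w) (expR (z * (p - 1)) *: H u).
Proof.
move=> u0 w0 z0 wu; have zu0 := orthantZ (expR_ge0 z) u0.
apply: (vle_trans (subgradient_mono phiH w0 zu0 wu)).
by rewrite expRM; apply: (subgradient_growth phiH u0); rewrite -expR0 ler_expR.
Qed.

(* Growth at the origin, a fixed point of scaling, forces [H 0 >= 0]. *)
Lemma subgradient_ge0 u : orthant R m u -> orthant R m (H u).
Proof.
have p2 := p_ge2.
move=> u0; apply: (vle_trans _ (subgradient_mono phiH orthant0 u0 u0)) => i.
have h1 : vle 0 (expR 1 *: 0 : 'rV[R]_m) by rewrite scaler0.
have := subgradient_le_expR orthant0 orthant0 ler01 h1 i.
rewrite !mxE mul1r => h.
have p1 : 1 < expR (p - 1) by rewrite expR_gt1; lra.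
by move: h; rewrite -subr_ge0 -[X in _ - X]mul1r -mulrBl pmulr_rge0 ?subr_gt0.
Qed.

Lemma conj_at_ge u w : orthant R m u -> orthant R m w ->
  dot (H u) w - phi w <= conj_at phi H u.
Proof.
move=> u0 w0; have := subgradient_le phiH u0 w0.
by rewrite dotBr /conj_at; lra.
Qed.

Lemma conj_at_ge0 u : orthant R m u -> 0 <= conj_at phi H u.
Proof.
move=> u0; have := conj_at_ge u0 orthant0.
by rewrite dot0r (subgradient_fun0 phiH) subr0.
Qed.

Lemma subgradient_fun_mono u w : orthant R m u -> orthant R m (w - u) ->
  phi u <= phi w.
Proof.
move=> u0 wu0; have w0 : orthant R m w by rewrite -(subrK u w); exact: orthantD.
apply: le_trans (subgradient_le phiH u0 w0).
by rewrite lerDl dot_ge0//; exact: subgradient_ge0.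
Qed.

Lemma subgradient_fun_ge0 u : orthant R m u -> 0 <= phi u.
Proof.
move=> u0; rewrite -(subgradient_fun0 phiH).
by apply: subgradient_fun_mono; [exact: orthant0|rewrite subr0].
Qed.

(* The defect [b u = dot (H u) u - (p + 1) * phi u] satisfies [b u <= b (r u)]
   for this [r < 1], hence [b u <= b (r^k u) <= r^k * dot (H u) u] for all [k].
   (The sharp constant [p] would require integrating along the ray.) *)
Lemma subgradient_euler u : orthant R m u ->
  dot (H u) u <= (p + 1) * phi u.
Proof.
(* This [z] turns the second-order term [z ^+ 2 * p ^+ 2] in [key] into [z], leaving
   [1 + z + z ^+ 2 >= 1 + z]. *)
have p2 := p_ge2; pose z := (p ^+ 2)^-1; pose r := expR (- z).
have z0 : 0 < z by rewrite invr_gt0 exprn_gt0//; lra.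
have zp : z * p ^+ 2 = 1 by rewrite mulVf// expf_neq0//; lra.
have r0 : 0 < r by exact: expR_gt0.
have r1 : r < 1 by rewrite expR_lt1 oppr_lt0.
pose b w := dot (H w) w - (p + 1) * phi w.
have b_r w : orthant R m w -> b w <= b (r *: w).
  move=> w0; have rw0 := orthantZ (ltW r0) w0.
  have := subgradient_le phiH rw0 w0.
  rewrite /b dotBr dotZr.
  have : vle w (expR z *: (r *: w)).
    by move=> i; rewrite !mxE mulrA -expRD subrr expR0 mul1r.
  move=> /(subgradient_le_expR rw0 w0 (ltW z0)) /dot_lel => /(_ _ w0).
  rewrite dotZl; set E := dot (H (r *: w)) w => DE sg.
  have D0 : 0 <= dot (H w) w by rewrite dot_ge0//; exact: subgradient_ge0.
  have {}DE : (1 - z * (p - 1)) * dot (H w) w <= E.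
    have h1 : 1 - z * (p - 1) <= expR (- (z * (p - 1))) := expR_ge1Dx _.
    have h2 : expR (- (z * (p - 1))) * dot (H w) w <= E.
      by rewrite -ler_pdivlMl ?expR_gt0// expRN invrK.
    by apply: le_trans h2; rewrite ler_wpM2r.
  have rz : r * (1 + z) <= 1.
    rewrite -ler_pdivlMl ?expR_gt0// mulr1 -expRN opprK.
    exact: expR_ge1Dx.
  have E0 : 0 <= E by rewrite dot_ge0//; exact: subgradient_ge0.
  (* Since [phi w >= phi (r *: w) + (1 - r) * E], it suffices that
     [dot (H w) w <= (p + 1 - p * r) * E], which [DE] reduces to [key]. *)
  have key : 1 <= (p + 1 - p * r) * (1 - z * (p - 1)).
    have A0 : 0 <= 1 - z * (p - 1) by nra.
    have h1 : 1 + z * (p + 1) <= (1 + z) * (p + 1 - p * r) by nra.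
    have h2 : 1 + z <= (1 + z * (p + 1)) * (1 - z * (p - 1)).
      rewrite (_ : _ * _ = 1 + 2 * z - z * (z * p ^+ 2) + z ^+ 2); last by ring.
      by rewrite zp; nra.
    rewrite -(ler_pM2l (_ : 0 < 1 + z)) ?mulr1; last by lra.
    by rewrite mulrA; apply: le_trans h2 _; rewrite ler_wpM2r.
  have : dot (H w) w <= (p + 1 - p * r) * E.
    apply: le_trans
      (_ : (p + 1 - p * r) * ((1 - z * (p - 1)) * dot (H w) w) <= _).
      by rewrite mulrA ler_peMl.
    by rewrite ler_wpM2l//; nra.
  nra.
have b_rn k w : orthant R m w -> b w <= r ^+ k * dot (H w) w.
  elim: k w => [|k IHk] w w0.
    have := subgradient_fun_ge0 w0; rewrite /b expr0 mul1r => phi0.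
    by rewrite gerBl mulr_ge0//; lra.
  have rw0 := orthantZ (ltW r0) w0.
  apply: le_trans (b_r _ w0) (le_trans (IHk _ rw0) _).
  rewrite exprSr -mulrA ler_wpM2l ?exprn_ge0 ?(ltW r0)// dotZr.
  rewrite ler_wpM2l ?(ltW r0)//; apply: dot_lel => //.
  apply: (subgradient_mono phiH) => // i; rewrite mxE.
  by rewrite ler_piMl ?(ltW r1)//; move/orthantP: w0.
move=> u0; rewrite -subr_le0.
have cv : r ^+ k * dot (H u) u @[k --> \oo] --> 0 * dot (H u) u.
  by apply: cvgM; [apply: cvg_expr; rewrite gtr0_norm|exact: cvg_cst].
rewrite -(mul0r (dot (H u) u)) -(cvg_lim _ cv)//; apply: limr_ge.
  exact: cvgP cv.
by near=> k; exact: b_rn.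
Unshelve. all: end_near. Qed.

Lemma conj_at_le u : orthant R m u -> conj_at phi H u <= p * phi u.
Proof. by move=> /subgradient_euler; rewrite /conj_at mulrDl mul1r; lra. Qed.

(** * One round of the potential argument *)

Section step.
Variables (gbar : R).
Hypotheses (gbar_ge0 : 0 <= gbar) (gbar_le : gbar <= (4 * p)^-1).

Lemma potential_step (S v u : 'rV[R]_m) (g c : R) :
  (forall i, 4 * p <= S 0 i) -> (forall i, 0 <= v 0 i <= 1) -> 1 <= g ->
  c = 0 \/ c = gbar ->
  u = (4 * (g + gbar))^-1 *: S ->
  (g + c) * phi ((4 * (g + c))^-1 *: (S + v)) + c * conj_at phi H u <=
  g * phi ((4 * g)^-1 *: S) + dot (H u) (2^-1 *: v).
Proof.
have p2 := p_ge2; have gb0 := gbar_ge0; have gbp := gbar_le.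
move=> Sp v01 g1 cP uE.
have S0 : orthant R m S.
  by apply/orthantP => i; apply: le_trans (Sp i); lra.
have v0 : orthant R m v by apply/orthantP => i; case/andP: (v01 i).
have c0 : 0 <= c by case: cP => ->.
have u0 : orthant R m u.
  by rewrite uE; apply: orthantZ => //; rewrite invr_ge0; lra.
pose x := (4 * (g + c))^-1 *: S; pose a := (4 * (g + c))^-1 *: (S + v).
have x0 : orthant R m x by apply: orthantZ => //; rewrite invr_ge0; lra.
have a0 : orthant R m a.
  by apply: orthantZ; [rewrite invr_ge0; lra|exact: orthantD].
(* Raise the weight with [S] fixed. For [c = gbar] the point [x] is exactly [u], which is why the
   iterate has [gbar] in its denominator; [g] times the subgradient inequality at [u] then yields
   the conjugate term. *)
have scale : (g + c) * phi x + c * conj_at phi H u <= g * phi ((4 * g)^-1 *: S).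
  case: cP => cE; first by rewrite /x cE addr0 mul0r addr0.
  have y0 : orthant R m ((4 * g)^-1 *: S).
    by apply: orthantZ => //; rewrite invr_ge0; lra.
  have := subgradient_le phiH u0 y0; rewrite /conj_at.
  have -> : x = u by rewrite /x cE uE.
  have -> : (4 * g)^-1 *: S = (1 + c / g) *: u.
    by rewrite uE scalerA cE; congr (_ *: _); field; lra.
  have -> : (1 + c / g) *: u - u = (c / g) *: u.
    by rewrite scalerDl scale1r addrAC subrr add0r.
  have g0 : 0 <= g by lra.
  rewrite dotZr => /(ler_wpM2l g0).
  rewrite [X in X <= _ -> _](_ : _ = g * phi u + c * dot (H u) u); first lra.
  by field; lra.
(* Add [v]. The subgradient inequality at [a] bounds the increase by [4^-1 * dot (H a) v]; comparing
   [H a] with [2 *: H u] gives the [2^-1]. *)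
have shift : (g + c) * (phi a - phi x) <= dot (H u) (2^-1 *: v).
  have := subgradient_le phiH a0 x0.
  have -> : x - a = - (4 * (g + c))^-1 *: v.
    by rewrite /x /a -scalerBr opprD addNKr scalerN scaleNr.
  rewrite dotZr.
  have zE : 0 <= (2 * p)^-1 by rewrite invr_ge0; lra.
  have : vle a (expR (2 * p)^-1 *: u).
    move=> i; rewrite uE !mxE mulrCA.
    have Si : 4 * p <= S 0 i := Sp i.
    have /andP[vi0 vi] := v01 i.
    (* Two ratios are at most [1 + d]: that of [S + v] to [S], by the shift [4 * p <= S], and that
       of [g + gbar] to [g + c], by [gbar <= d] and [1 <= g + c]. *)
    pose d := (4 * p)^-1; have d0 : 0 < d by rewrite invr_gt0; lra.
    have dp : d * (4 * p) = 1 by rewrite mulVf//; lra.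
    have dE : (1 + d) * (1 + d) <= expR (2 * p)^-1.
      have -> : (2 * p)^-1 = d + d by rewrite /d; field; lra.
      by rewrite expRD ler_pM ?expR_ge1Dx//; lra.
    rewrite ler_pdivrMl; last by lra.
    rewrite [leRHS](_ : _ = (4 * (g + gbar))^-1 *
      (4 * (g + c) * (expR (2 * p)^-1 * S 0 i))); last by ring.
    rewrite ler_pdivlMl; last by lra.
    have h1 : S 0 i + v 0 i <= (1 + d) * S 0 i by nra.
    have h2 : g + gbar <= (1 + d) * (g + c) by rewrite -/d in gbp; nra.
    have h3 : (g + gbar) * (S 0 i + v 0 i) <=
        ((1 + d) * (g + c)) * ((1 + d) * S 0 i).
      by apply: ler_pM => //; [lra|lra].
    have h4 : (g + c) * S 0 i * ((1 + d) * (1 + d)) <=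
        (g + c) * S 0 i * expR (2 * p)^-1.
      by apply: ler_wpM2l => //; apply: mulr_ge0; lra.
    lra.
  move=> /(subgradient_le_expR u0 a0 zE) /dot_lel => /(_ _ v0).
  rewrite dotZl dotZr => h1 h2.
  (* The exponent is at most 1/2, and [expR 2^-1 <= 2] is the inverse of
     [expR (- 2^-1) >= 1 - 2^-1]. *)
  have h3 : expR ((2 * p)^-1 * (p - 1)) <= 2.
    have half : (2 * p)^-1 * (p - 1) <= 2^-1.
      by rewrite ler_pdivrMl; lra.
    apply: le_trans (_ : expR 2^-1 <= _); first by rewrite ler_expR.
    rewrite -[leLHS]invrK -expRN -[leRHS]invrK lef_pV2 ?posrE ?expR_gt0//.
    by apply: le_trans (expR_ge1Dx _); lra.
  have uv0 : 0 <= dot (H u) v by rewrite dot_ge0//; exact: subgradient_ge0.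
  have h4 : dot (H a) v <= 2 * dot (H u) v.
    by apply: le_trans h1 _; rewrite ler_wpM2r.
  have : (g + c) * (phi a - phi x) <= 4^-1 * dot (H a) v.
    have : (g + c) * (phi a - phi x) <=
        (g + c) * ((4 * (g + c))^-1 * dot (H a) v).
      by rewrite ler_wpM2l; lra.
    by rewrite mulrA invfM mulrCA divff ?mulr1; lra.
  lra.
rewrite -/a; lra.
Qed.
End step.

End subgradient.

(** * The gradient of a convex function as a subgradient *)

Lemma gradient_le (R : realType) (m : nat) (psi : 'rV[R]_m -> R)
    (u w g : 'rV[R]_m) :
  convex_function (orthant R m) psi -> is_gradient psi u g ->
  orthant R m u -> orthant R m w -> psi u + dot g (w - u) <= psi w.
Proof.
move=> psi_convex /eqoP gP u0 w0; apply/ler_addgt0Pr => e e0.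
pose N := 1 + `|w - u|; have N0 : 0 < N by rewrite ltr_pwDl.
have eN0 : 0 < e / N by rewrite divr_gt0.
move: (gP _ eN0) => /nbhs_normP [r /= r0 rP].
(* At [x] differentiability bounds [psi] from below and convexity from above; dividing by [t] leaves
   an error of at most [e]. The cap 1 keeps [x] on the segment, the other keeps it within [r] of
   [u]. *)
pose t := Num.min 1 (r / N / 2).
have t0 : 0 < t by rewrite lt_min ltr01 !divr_gt0.
have t1 : t <= 1 by rewrite ge_min lexx.
have tN : t * N < r.
  apply: le_lt_trans (_ : r / N / 2 * N < r).
    by rewrite ler_pM2r// ge_min lexx orbT.
  by rewrite mulrAC divfK ?gt_eqF//; lra.
pose x := u + t *: (w - u).
have xE : x = t *: w + (1 - t) *: u.
  by rewrite /x scalerBr scalerBl scale1r addrCA.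
have x0 : orthant R m x.
  by rewrite xE; apply: orthantD; apply: orthantZ => //; lra.
have xu : x - u = t *: (w - u) by rewrite /x addrC addKr.
have cvx : psi x <= t * psi w + (1 - t) * psi u.
  by rewrite xE; apply: (psi_convex (Itv01 (ltW t0) t1)); rewrite inE.
have nxu : `|x - u| = t * `|w - u| by rewrite xu normrZ gtr0_norm.
have near_u : `|u - x| < r.
  rewrite distrC nxu; apply: le_lt_trans tN.
  by rewrite ler_pM2l// /N; lra.
have := rP x near_u x0.
rewrite nxu xu dotZr => /ler_normlP[h _].
have h2 : e / N * (t * `|w - u|) <= t * e.
  rewrite mulrCA ler_pM2l// -mulrA ler_piMr ?(ltW e0)// mulrC ler_pdivrMr//.
  by rewrite mul1r /N; lra.
rewrite -subr_ge0 -(pmulr_rge0 _ t0).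
lra.
Qed.

Lemma grad_subgradient (R : realType) (m : nat) (p : R) (psi : 'rV[R]_m -> R) :
  convex_function (orthant R m) psi -> differentiable_on_orthant psi ->
  psi 0 = 0 -> monotone_gradient psi -> growth_at_most p psi ->
  growing_subgradient p psi (grad psi).
Proof.
move=> cvx diff psi0 mono growth; split=> // u w u0 w0.
by apply: gradient_le => //; exact: xgetPex (diff u u0).
Qed.

(** * Regret, size and monotonicity along the iterates *)

Section ssftrl.
Context {R : realType} {m n : nat} {p gbar : R}.
Variables (phi : 'rV[R]_m -> R) (H : 'rV[R]_m -> 'rV[R]_m).
Variables (v : 'I_n -> 'rV[R]_m) (gamma : 'I_n -> R).
Hypotheses (p_ge2 : 2 <= p) (phiH : growing_subgradient p phi H).
Hypotheses (gbar_ge0 : 0 <= gbar) (gbar_le : gbar <= (4 * p)^-1).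
Hypothesis v01 : forall t i, 0 <= v t 0 i <= 1.
Hypothesis gamma_val : forall t, gamma t = 0 \/ gamma t = gbar.

(** [cumul], [weight] and [ssftrl_point] do not involve [phi], so [psi] and its coordinates share
    them. Indexing by [nat] allows [k = n], the state after the last round. *)
Definition cumul (k : nat) : 'rV[R]_m :=
  const_mx (4 * p) + \sum_(s < n | (s < k)%N) v s.

Definition weight (k : nat) : R := 1 + \sum_(s < n | (s < k)%N) gamma s.

Definition ssftrl_point (k : nat) : 'rV[R]_m :=
  (4 * (weight k + gbar))^-1 *: cumul k.

(** The perspective of [phi] at [4^-1 *: cumul k] with scale [weight k]. *)
Definition potential (k : nat) : R :=
  weight k * phi ((4 * weight k)^-1 *: cumul k).

Lemma gamma_ge0 t : 0 <= gamma t.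
Proof. by case: (gamma_val t) => ->. Qed.

Lemma v_orthant t : orthant R m (v t).
Proof. by apply/orthantP => i; case/andP: (v01 t i). Qed.

Lemma weight_ge1 k : 1 <= weight k.
Proof. by rewrite lerDl sumr_ge0// => t _; exact: gamma_ge0. Qed.

Lemma weight_le j k : (j <= k)%N -> weight j <= weight k.
Proof.
move=> jk; rewrite lerD2l [leRHS](bigID (fun s : 'I_n => (s < j)%N))/=.
rewrite (eq_bigl (fun s : 'I_n => (s < k)%N && (s < j)%N)) ?lerDl ?sumr_ge0//.
  by move=> t _; exact: gamma_ge0.
by move=> s; rewrite andbC; case: ltnP => // sj; rewrite (leq_trans sj jk).
Qed.

Lemma cumul_le j k : (j <= k)%N -> vle (cumul j) (cumul k).
Proof.
move=> jk i; rewrite !mxE lerD2l !summxE.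
rewrite [leRHS](bigID (fun s : 'I_n => (s < j)%N))/=.
rewrite (eq_bigl (fun s : 'I_n => (s < k)%N && (s < j)%N)) ?lerDl ?sumr_ge0//.
  by move=> t _; move: (v01 t i) => /andP[].
by move=> s; rewrite andbC; case: ltnP => // sj; rewrite (leq_trans sj jk).
Qed.

Lemma cumul_ge k i : 4 * p <= cumul k 0 i.
Proof.
by apply: le_trans (cumul_le (leq0n k) i); rewrite /cumul big_pred0// addr0 mxE.
Qed.

Lemma cumul_orthant k : orthant R m (cumul k).
Proof.
have p2 := p_ge2; apply/orthantP => i; apply: le_trans (cumul_ge k i).
lra.
Qed.

Lemma ssftrl_point_orthant k : orthant R m (ssftrl_point k).
Proof.
have g1 := weight_ge1 k; have gb0 := gbar_ge0.
by apply: orthantZ (cumul_orthant k); rewrite invr_ge0; lra.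
Qed.

Lemma potential_le k : (k <= n)%N ->
  potential k +
    \sum_(s < n | (s < k)%N) gamma s * conj_at phi H (ssftrl_point s) <=
  phi (const_mx p) +
    \sum_(s < n | (s < k)%N) dot (H (ssftrl_point s)) (2^-1 *: v s).
Proof.
pose bound j := potential j +
    \sum_(s < n | (s < j)%N) gamma s * conj_at phi H (ssftrl_point s) <=
  phi (const_mx p) +
    \sum_(s < n | (s < j)%N) dot (H (ssftrl_point s)) (2^-1 *: v s).
have step (t : 'I_n) : bound t -> bound t.+1.
  have := potential_step p_ge2 phiH gbar_ge0 gbar_le (cumul_ge t) (v01 t)
    (weight_ge1 t) (gamma_val t) (erefl (ssftrl_point t)).
  rewrite /bound !sum_ord_ltS /potential.
  rewrite (_ : weight t.+1 = weight t + gamma t); last first.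
    by rewrite /weight sum_ord_ltS addrA.
  rewrite (_ : cumul t.+1 = cumul t + v t); last first.
    by rewrite /cumul sum_ord_ltS addrA.
  lra.
rewrite -/(bound k); elim: k => [_|k IHk kn].
  rewrite /bound !big_pred0// !addr0 /potential /weight /cumul !big_pred0//.
  rewrite !addr0 mulr1 mul1r (_ : 4^-1 *: _ = const_mx p)//.
  by apply/rowP => i; rewrite !mxE mulKf.
exact: (step (Ordinal kn)) (IHk (ltnW kn)).
Qed.

(** Dropping [gbar] from the denominator enlarges the point, and the factor [weight k] is at least
    1. *)
Lemma potential_ge k : phi (ssftrl_point k) <= potential k.
Proof.
have g1 := weight_ge1 k; have gb0 := gbar_ge0; have S0 := cumul_orthant k.
have x0 : orthant R m ((4 * weight k)^-1 *: cumul k).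
  by apply: orthantZ S0; rewrite invr_ge0; lra.
apply: le_trans (_ : phi ((4 * weight k)^-1 *: cumul k) <= _).
  apply: (subgradient_fun_mono p_ge2 phiH) (ssftrl_point_orthant k) _.
  rewrite -scalerBl; apply: orthantZ S0.
  by rewrite subr_ge0 lef_pV2 ?posrE; lra.
by rewrite ler_peMl//; exact: subgradient_fun_ge0 phiH _ x0.
Qed.

Lemma conj_at_ssftrl_le (t : 'I_n) :
  p^-1 * conj_at phi H (ssftrl_point t) <=
  \sum_(s < n) dot (H (ssftrl_point s)) (v s) + phi (const_mx p).
Proof.
have p2 := p_ge2.
have dot0 (s : 'I_n) : 0 <= dot (H (ssftrl_point s)) (v s).
  apply: dot_ge0 (v_orthant s).
  exact: subgradient_ge0 phiH _ (ssftrl_point_orthant s).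
have conj0 : 0 <= \sum_(s < n | (s < t)%N)
    gamma s * conj_at phi H (ssftrl_point s).
  apply: sumr_ge0 => s _; rewrite mulr_ge0 ?gamma_ge0//.
  exact: conj_at_ge0 phiH _ (ssftrl_point_orthant s).
apply: le_trans (_ : potential t <= _).
  apply: le_trans (potential_ge t).
  rewrite ler_pdivrMl; last by lra.
  exact: conj_at_le phiH _ (ssftrl_point_orthant t).
apply: (le_trans _ (le_trans (potential_le (ltnW (ltn_ord t))) _)).
  by rewrite lerDl.
(* Extending the sum to all rounds and doubling its terms only increases it, as all products are
   nonnegative. *)
rewrite addrC lerD2r [leRHS](bigID (fun s : 'I_n => (s < t)%N))/=.
rewrite -[leLHS]addr0 lerD ?sumr_ge0//; apply: ler_sum => s _.
by rewrite dotZr; have := dot0 s; lra.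
Qed.

(** At weight 2, the initial 1 plus the total of [gamma], the potential is twice [phi] at a point
    above [8^-1 *: \sum_s v s]; one of the two copies is discarded. *)
Lemma ssftrl_regret : weight n = 2 ->
  phi (8^-1 *: \sum_s v s) - phi (const_mx p) <=
  \sum_(s < n) (dot (H (ssftrl_point s)) (2^-1 *: v s) -
          gamma s * conj_at phi H (ssftrl_point s)).
Proof.
have p2 := p_ge2.
have all_lt (s : 'I_n) : (s < n)%N = true by exact: ltn_ord.
move=> w2; have := potential_le (leqnn n).
rewrite /potential w2 /cumul !(eq_bigl _ _ all_lt) sumrB => h.
set V := \sum_s v s in h *.
have V0 : orthant R m V by apply: orthant_sum => s; exact: v_orthant.
have V80 : orthant R m (8^-1 *: V) by apply: orthantZ.
have := subgradient_fun_ge0 p_ge2 phiH V80.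
have : phi (8^-1 *: V) <= phi ((4 * 2)^-1 *: (const_mx (4 * p) + V)).
  apply: (subgradient_fun_mono p_ge2 phiH) => //.
  rewrite (_ : 4 * 2 = 8); last by ring.
  rewrite -scalerBr addrK; apply: orthantZ => //.
  by apply: orthant_const; lra.
lra.
Qed.

(** As [cumul] is non-decreasing, only the weights can make the earlier point larger, by a factor at
    most [1 + (weight t - weight s)] since [weight s + gbar >= 1]. *)
Lemma ssftrl_le (s t : 'I_n) : (s <= t)%N ->
  vle (H (ssftrl_point s))
    (expR ((weight t - weight s) * (p - 1)) *: H (ssftrl_point t)).
Proof.
move=> st; have gs := weight_ge1 s; have gst := weight_le st.
have gb0 := gbar_ge0.
apply: (subgradient_le_expR phiH (ssftrl_point_orthant t)
  (ssftrl_point_orthant s)); first by rewrite subr_ge0.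
move=> i; rewrite [leLHS]mxE [leRHS]mxE [X in _ <= _ * X]mxE.
rewrite ler_pdivrMl; last by lra.
have St : 0 <= cumul t 0 i by move: i; apply/orthantP; exact: cumul_orthant.
apply: le_trans (cumul_le st i) _.
rewrite [leRHS](_ : _ = (4 * (weight t + gbar))^-1 *
  (4 * (weight s + gbar) * expR (weight t - weight s) * cumul t 0 i)).
  rewrite ler_pdivlMl; last by lra.
  apply: ler_wpM2r => //.
  have := expR_ge1Dx (weight t - weight s); nra.
by ring.
Qed.

End ssftrl.

(** The supremum is attained at [u], hence finite: this turns the extended-real claims into real
    inequalities. *)
Lemma fenchel_subgradient (R : realType) (m : nat) (p : R)
    (phi : 'rV[R]_m -> R) (H : 'rV[R]_m -> 'rV[R]_m) (u : 'rV[R]_m) :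
  growing_subgradient p phi H -> orthant R m u ->
  fenchel phi (H u) = (conj_at phi H u)%:E.
Proof.
move=> phiH u0; apply/eqP; rewrite eq_le; apply/andP; split.
  apply: ge_ereal_sup => _ [w w0 <-].
  by rewrite lee_fin dotC; exact: conj_at_ge phiH _ _ u0 w0.
by apply: ereal_sup_ubound; exists u => //; rewrite dotC.
Qed.

(** * Coordinates of a separable function *)

Section separable.
Context {R : realType} {m : nat}.
Implicit Types (u w g : 'rV[R]_m).

(** A coordinate stays a vector of dimension [m], so the estimates above apply to [psi] restricted
    to an axis. *)
Definition axis (i : 'I_m) u : 'rV[R]_m := u 0 i *: delta_mx 0 i.

Lemma axisE i u j : axis i u 0 j = if j == i then u 0 i else 0.
Proof. by rewrite !mxE eqxx/=; case: (j == i); rewrite ?mulr1 ?mulr0. Qed.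

Lemma axis_orthant i u : orthant R m u -> orthant R m (axis i u).
Proof.
by move=> /orthantP u0; apply/orthantP => j; rewrite axisE; case: ifP.
Qed.

Lemma dot_axis i g u : dot (axis i g) u = g 0 i * u 0 i.
Proof.
rewrite /dot (bigD1 i)//= big1 => [|j /negbTE ji]; rewrite axisE ?eqxx ?addr0//.
by rewrite ji mul0r.
Qed.

(** The summands [f i] may be nonzero at 0, but their values there add up to [psi 0 = 0];
    [psi (axis i u)] is [f i] normalised to vanish at 0. *)
Lemma separable_sum_axis (psi : 'rV[R]_m -> R) u :
  separable psi -> psi 0 = 0 -> orthant R m u ->
  psi u = \sum_i psi (axis i u).
Proof.
move=> [f fE] psi0 u0.
have f0 : \sum_i f i 0 = 0.
  rewrite -[RHS]psi0 (fE _ orthant0).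
  by apply: eq_bigr => i _; rewrite mxE.
have axisfE i : psi (axis i u) = f i (u 0 i) - f i 0.
  rewrite (fE _ (axis_orthant i u0)) -[LHS]subr0 -[X in _ - X]f0 -sumrB.
  rewrite (bigD1 i)//= big1 => [|j /negbTE ji]; rewrite axisE ?eqxx ?addr0//.
  by rewrite ji subrr.
by rewrite (eq_bigr _ (fun i _ => axisfE i)) sumrB f0 subr0 (fE _ u0).
Qed.

Lemma axis_subgradient (p : R) (psi : 'rV[R]_m -> R)
    (H : 'rV[R]_m -> 'rV[R]_m) i :
  separable psi -> growing_subgradient p psi H ->
  growing_subgradient p (fun u => psi (axis i u)) (fun u => axis i (H u)).
Proof.
move=> sep psiH; have psi0 := subgradient_fun0 psiH; split.
- move=> u w u0 w0.
  (* Only coordinate [i] of [u] changes, so all other terms cancel from the subgradient inequality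
     of [psi]. *)
  pose x : 'rV[R]_m := \row_j (if j == i then w 0 i else u 0 j).
  have x0 : orthant R m x.
    apply/orthantP => j; rewrite mxE.
    by case: ifP => _; [move/orthantP: w0|move/orthantP: u0].
  have := subgradient_le psiH u0 x0.
  rewrite (separable_sum_axis sep psi0 u0) (separable_sum_axis sep psi0 x0).
  have -> : dot (H u) (x - u) = dot (axis i (H u)) (w - u).
    rewrite dot_axis /dot (bigD1 i)//= big1 => [|j /negbTE ji].
      by rewrite !mxE eqxx addr0.
    by rewrite !mxE ji subrr mulr0.
  rewrite (bigD1 i)//= [X in _ <= X -> _](bigD1 i)//=.
  rewrite (_ : axis i x = axis i w); last by rewrite /axis mxE eqxx.
  have -> : \sum_(j | j != i) psi (axis j x) = \sum_(j | j != i) psi (axis j u).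
    by apply: eq_bigr => j /negbTE ji; rewrite /axis mxE ji.
  by rewrite addrAC lerD2r.
- move=> u w u0 w0 uw j; rewrite !axisE; case: ifP => // _.
  exact: (subgradient_mono psiH).
- move=> u c u0 c1 j; rewrite [leRHS]mxE !axisE.
  case: ifP => _; rewrite ?mulr0//.
  by have := subgradient_growth psiH u0 c1 i; rewrite mxE.
- by rewrite /axis mxE scale0r.
Qed.

End separable.

(** * Attained maxima and last elements of buckets *)

Lemma vmax_attained (R : realType) (m n : nat) (y : 'I_n -> 'rV[R]_m) i :
  (0 < n)%N -> exists t, vmax y 0 i <= y t 0 i.
Proof.
move=> n0; pose t0 := Ordinal n0.
case: (@Order.TotalTheory.arg_maxP _ _ _ t0 xpredT (fun t => y t 0 i))
  => // t _ ty.
exists t; rewrite mxE; apply: ge_sup; first by exists (y t0 0 i); exists t0.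
by move=> _ [s _ <-]; exact: ty.
Qed.

Lemma exists_superset_card (T : finType) (A : {set T}) (q : nat) :
  (#|A| <= q <= #|T|)%N -> exists2 B : {set T}, A \subset B & #|B| = q.
Proof.
move=> /andP[Aq qT]; elim: q => [|q IHq] in Aq qT *.
  by exists A => //; apply/eqP; rewrite -leqn0.
move: Aq; rewrite leq_eqVlt => /predU1P[<-|Aq]; first by exists A.
have [B AB Bq] := IHq Aq (ltnW qT).
have /card_gt0P[x] : (0 < #|~: B|)%N.
  by rewrite cardsCs finset.setCK subn_gt0 Bq.
rewrite inE => xB; exists (x |: B); last by rewrite cardsU1 xB Bq.
exact: fintype.subset_trans AB (finset.subsetUr _ _).
Qed.

(** Each bucket has at most one last time; arbitrary times make up for empty buckets to reach
    exactly [q]. *)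
Lemma exists_bucket_last (n q : nat) (F : 'I_n -> 'I_q) : (q <= n)%N ->
  exists T : {set 'I_n}, #|T| = q /\
    forall t : 'I_n, exists2 s : 'I_n, s \in T & (t <= s)%N /\ F s = F t.
Proof.
move=> qn.
pose A := finset (fun t => [forall s : 'I_n, (F s == F t) ==> (s <= t)%N]).
have F_inj : {in A &, injective F}.
  move=> s t; rewrite !inE => /forallP sA /forallP tA Fst.
  apply/val_inj/anti_leq.
  by have := sA t; have := tA s; rewrite Fst eqxx/= => -> ->.
have Aq : (#|A| <= q)%N.
  by rewrite -(card_in_imset F_inj) -[leqRHS]card_ord max_card.
have [|T AT Tq] := @exists_superset_card _ A q; first by rewrite card_ord Aq qn.
exists T; split=> // t.
case: (@arg_maxnP _ t (fun s => F s == F t) (fun s => s : nat))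
  => // s /eqP Fs sP.
exists s; last by split=> //; apply: sP.
apply: (fintype.subsetP AT); rewrite inE; apply/forallP => r.
by rewrite Fs; apply/implyP/sP.
Qed.

(** * The four guarantees of SSFTRL *)

Theorem theorem4 (R : realType) (m n : nat) (p : R) (psi : 'rV[R]_m -> R)
    (v : 'I_n -> 'rV[R]_m) (gbar : R) (gamma : 'I_n -> R)
    (m_ge1 : (1 <= m)%N) (n_ge1 : (1 <= n)%N) (p_ge2 : 2 <= p)
    (psi_ge0 : forall u, orthant R m u -> 0 <= psi u)
    (psi_convex : convex_function (orthant R m) psi)
    (psi_diff : differentiable_on_orthant psi)
    (psi_mono : monotone_on_orthant psi)
    (psi0 : psi 0 = 0)
    (psi_grad_mono : monotone_gradient psi)
    (psi_growth : growth_at_most p psi)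
    (v01 : forall t i, 0 <= v t 0 i <= 1)
    (gbar_le : gbar <= (4 * p)^-1)
    (gamma_val : forall t, gamma t = 0 \/ gamma t = gbar)
    (gamma_sum : \sum_t gamma t = 1)
    (y := ssftrl psi p gbar v gamma) :
  [/\ ((psi (8^-1 *: \sum_t v t) - psi (const_mx p))%:E
         <= \sum_(t < n) Lgame psi (gamma t) (y t) (2^-1 *: v t))%E,
      ((p^-1)%:E * \big[maxe/-oo]_(t < n) fenchel psi (y t)
         <= (\sum_t dot (y t) (v t) + psi (const_mx p))%R%:E)%E,
      (separable psi ->
        ((p^-1)%:E * fenchel psi (vmax y)
           <= (\sum_t dot (y t) (v t) + psi (const_mx p))%R%:E)%E) &
      exists T : {set 'I_n}, #|T| = Num.truncn p /\
        forall t, exists2 t', t' \in T & vle (y t) (expR 1 *: y t')].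
Proof.
have gbar_ge0 : 0 <= gbar.
  rewrite leNgt; apply/negP => gbar_lt0.
  have : \sum_t gamma t <= 0.
    by apply: sumr_le0 => t _; case: (gamma_val t) => -> //; exact: ltW.
  by rewrite gamma_sum ler10.
have psiG := grad_subgradient psi_convex psi_diff psi0 psi_grad_mono psi_growth.
pose u (t : 'I_n) := @ssftrl_point R m n p gbar v gamma t.
have u0 t : orthant R m (u t).
  exact: ssftrl_point_orthant p_ge2 gbar_ge0 v01 gamma_val t.
have yE t : y t = grad psi (u t) by [].
have fE t : fenchel psi (y t) = (conj_at psi (grad psi) (u t))%:E.
  by rewrite yE (fenchel_subgradient psiG).
have wn : weight gamma n = 2.
  rewrite /weight (eq_bigl xpredT) ?gamma_sum//.
  by move=> s; rewrite ltn_ord.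
have p0 : 0 < p by lra.
split.
- have LE t : Lgame psi (gamma t) (y t) (2^-1 *: v t) =
      (dot (y t) (2^-1 *: v t) - gamma t * conj_at psi (grad psi) (u t))%:E.
    by rewrite /Lgame fE.
  rewrite (eq_bigr _ (fun t _ => LE t)) sumEFin lee_fin.
  exact: ssftrl_regret p_ge2 psiG gbar_ge0 gbar_le v01 gamma_val wn.
- rewrite lee_pdivrMl//; apply: bigmax_le => [|t _]; first exact: leNye.
  rewrite fE -EFinM lee_fin -ler_pdivrMl//.
  exact: conj_at_ssftrl_le p_ge2 psiG gbar_ge0 gbar_le v01 gamma_val t.
- move=> sep; rewrite lee_pdivrMl//; apply: ge_ereal_sup => _ [w w0 <-].
  rewrite -EFinM lee_fin.
  rewrite (separable_sum_axis sep psi0 w0).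
  rewrite (separable_sum_axis sep psi0 (orthant_const (ltW p0))).
  have -> : \sum_t dot (y t) (v t) = \sum_i \sum_t dot (axis i (y t)) (v t).
    rewrite exchange_big/=; apply: eq_bigr => t _.
    by apply: eq_bigr => i _; rewrite dot_axis.
  rewrite -big_split/= mulr_sumr -sumrB; apply: ler_sum => i _.
  have psiGi := axis_subgradient i sep psiG.
  (* The maximising round may depend on [i]; each coordinate uses the size bound at its own round,
     and both right-hand terms split over [i]. *)
  have [t yt] := vmax_attained y i n_ge1.
  apply: le_trans (_ : conj_at (fun u => psi (axis i u))
    (fun u => axis i (grad psi u)) (u t) <= _).
    apply: le_trans (conj_at_ge psiGi (u0 t) w0).
    rewrite lerD2r dot_axis mulrC ler_wpM2r//.
    by move: i {psiGi yt}; apply/orthantP.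
  rewrite -ler_pdivrMl//.
  exact: conj_at_ssftrl_le p_ge2 psiGi gbar_ge0 gbar_le v01 gamma_val t.
- have trunc_p := truncn_itv (ltW p0).
  pose F (t : 'I_n) : R := (p - 1) * (weight gamma t - 1).
  have F0 t : 0 <= F t.
    apply: mulr_ge0; rewrite subr_ge0; first lra.
    exact: weight_ge1 gbar_ge0 gamma_val t.
  (* [F t] is at most [p - 1], which is below [Num.truncn p] even for non-integer [p]. *)
  have Fq t : (Num.truncn (F t) < Num.truncn p)%N.
    rewrite truncn_lt_nat//; case/andP: trunc_p => _; rewrite -natr1 /F.
    have := weight_le gbar_ge0 gamma_val (ltnW (ltn_ord t)); rewrite wn.
    nra.
  (* Values at most [(4 * p)^-1] summing to 1 need at least [4 * p] rounds. *)
  have qn : (Num.truncn p <= n)%N.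
    rewrite -(ler_nat R); case/andP: trunc_p => qp _; apply: le_trans qp _.
    have : \sum_(t < n) gamma t <= \sum_(t < n) (4 * p)^-1.
      apply: ler_sum => t _; case: (gamma_val t) => -> //.
      by rewrite invr_ge0; lra.
    rewrite gamma_sum sumr_const card_ord -[_ *+ n]mulr_natr.
    by rewrite ler_pdivlMl ?mulr_gt0//; lra.
  have [T [Tq TP]] := exists_bucket_last (fun t => Ordinal (Fq t)) qn.
  exists T; split=> // t; have [s sT [ts /(congr1 val)/= Fst]] := TP t.
  exists s => //.
  apply: (vle_trans (ssftrl_le p_ge2 psiG gbar_ge0 v01 gamma_val ts)) => i.
  rewrite [leLHS]mxE [leRHS]mxE; apply: ler_wpM2r.
    by move: i; apply/orthantP; exact: subgradient_ge0 p_ge2 psiG _ (u0 s).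
  rewrite ler_expR.
  (* Equal truncations put [F s] and [F t] within 1 of each other, so the exponent is at most 1. *)
  have := truncn_itv (F0 t); have := truncn_itv (F0 s).
  rewrite Fst -natr1 /F; lra.
Qed.
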